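(* Let $G$ be a connected graph with $n$ vertices and $m$ edges. Then $$n^2m\ \ge\ MSD^{3/2}(G)+4\,Sz(G)-2\,MS_2(G),$$ with equality if and only if $G$ is a bipartite graph.
   Context: All graphs are finite and simple. $d(u)$ is the degree of a vertex $u$; $d(u,v)$ is the graph distance; the transmission of $v$ is $\sigma(v)=\sum_{u\in V(G)}d(v,u)$. For an edge $uv$, $N_u$ is the number of vertices of $G$ whose distance to $u$ is smaller than their distance to $v$, and $N_v$ is the number of vertices whose distance to $v$ is smaller than their distance to $u$. The Szeged index is $Sz(G)=\sum_{uv\in E(G)}N_uN_v$. Further, $MSD^{3/2}(G)=\sum_{u\in V(G)}d(u)\sigma(u)^2$ (the superscript is an index parameter, not a power) and $MS_2(G)=\sum_{uv\in E(G)}\sigma(u)\sigma(v)$. *)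

(* Defs.v *)
From mathcomp Require Import all_boot.

Set Implicit Arguments.
Unset Strict Implicit.
Unset Printing Implicit Defensive.

(* A finite simple graph is a symmetric irreflexive relation
   [e : rel T] on a finType [T] of vertices. *)

Section Graph.
Variables (T : finType) (e : rel T).

Definition connected : Prop := forall u v : T, connect e u v.

Definition bipartite : Prop :=
  exists A : {set T}, forall u v : T, e u v -> (u \in A) != (v \in A).

(* Edges are unordered: each edge is the two-element set of its endpoints. *)
Definition edges : {set {set T}} := [set [set u; v] | u in T, v in e u].

Definition degree (u : T) : nat := #|[set v | e u v]|.

(* Some [u]-[v] walk has exactly [k] edges. *)
Definition walk_of_length (u v : T) (k : nat) : bool :=
  [exists p : k.-tuple T, path e u p && (last u p == v)].

(* The least length of a [u]-[v] walk.  A shortest walk has fewer than [#|T|]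
   edges; the value is [#|T|] when [v] is unreachable from [u]. *)
Definition dist (u v : T) : nat := find (walk_of_length u v) (iota 0 #|T|).

Definition transmission (v : T) : nat := \sum_(u : T) dist v u.

(* [closer u v] is N_u for the edge uv. *)
Definition closer (u v : T) : nat := #|[set w | dist w u < dist w v]|.

(* For [E = [set u; v]] with [u != v], the double product is
   [closer u v * closer v u]. *)
Definition Szeged : nat :=
  \sum_(E in edges) \prod_(u in E) \prod_(v in E :\ u) closer u v.

Definition MSD32 : nat := \sum_(u : T) degree u * transmission u ^ 2.

Definition MS2 : nat := \sum_(E in edges) \prod_(u in E) transmission u.

End Graph.

(* Main.v *)
Require Import Defs.
From mathcomp Require Import all_boot all_order all_algebra.
From mathcomp Require Import zify ring.

(** Write N_0 for the number of vertices equidistant from the two ends of an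
    edge uv, so that N_u + N_v + N_0 = n.  The distances from any vertex to u
    and to v differ by at most 1, so summing them over all vertices gives
    sigma(u) - sigma(v) = N_v - N_u.  Hence
      sigma(u)^2 + sigma(v)^2 - 2 sigma(u) sigma(v) + 4 N_u N_v
        = (N_u - N_v)^2 + 4 N_u N_v = (N_u + N_v)^2 <= n^2,
    with equality exactly when N_0 = 0 (lemma [edge_bound]).  Summing over the
    edges gives the inequality, because each vertex u lies on d(u) edges and
    therefore MSD^{3/2} is the sum of sigma(u)^2 + sigma(v)^2 over the edges uv
    (lemma [handshake]).

    Equality holds iff no edge has an equidistant vertex, and this
    characterizes bipartite graphs (lemma [bipartite_noequidistant]): in a
    bipartite graph the parity of a walk is determined by its ends, so the two
    ends of an edge lie at distances of different parity from any vertex;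
    conversely, the parity of the distance to a fixed root is then a proper
    2-colouring. *)

Set Implicit Arguments.
Unset Strict Implicit.
Unset Printing Implicit Defensive.

Lemma card_sum_nat (T : finType) (P : pred T) :
  #|[set x | P x]| = \sum_x (P x : nat).
Proof.
by rewrite -sum1dep_card big_mkcond; apply: eq_bigr => x _; case: (P x).
Qed.

Section GraphDistance.
Variables (T : finType) (e : rel T).
Hypotheses (e_sym : symmetric e) (e_irr : irreflexive e).
Hypothesis e_conn : connected e.

Lemma walk_of_lengthP u v k :
  reflect (exists p, [/\ size p = k, path e u p & last u p = v])
          (walk_of_length e u v k).
Proof.
apply: (iffP existsP) => [[p /andP [pth /eqP lst]]|[p [<- pth lst]]].
  by exists p; rewrite size_tuple.
by exists (in_tuple p); rewrite /= pth lst eqxx.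
Qed.

(** The search that defines [dist] only tries lengths below [#|T|]; for longer
    walks the bound holds because [dist] never exceeds [#|T|]. *)
Lemma dist_le_walk u v k : walk_of_length e u v k -> dist e u v <= k.
Proof.
move=> walk_k; rewrite leqNgt; apply/negP => lt_k.
have lt_kT : k < #|T|.
  by rewrite (leq_trans lt_k) // -[leqRHS](size_iota 0) find_size.
by have := before_find 0 lt_k; rewrite nth_iota // add0n walk_k.
Qed.

Lemma dist_walk u v : walk_of_length e u v (dist e u v).
Proof.
have has_walk : has (walk_of_length e u v) (iota 0 #|T|).
  have /connectP [p0 pth0 ->] := e_conn u v.
  (* A loop-free walk has fewer than #|T| edges. *)
  case: (shortenP pth0) => p pth uniq_p _.
  apply/hasP; exists (size p); last by apply/walk_of_lengthP; exists p.
  by have := max_card [in u :: p]; rewrite (card_uniqP uniq_p) mem_iota.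
have := nth_find 0 has_walk.
by rewrite nth_iota // -[ltnRHS](size_iota 0) -has_find.
Qed.

Lemma dist_sym u v : dist e u v = dist e v u.
Proof.
suff le_dist : forall x y, dist e x y <= dist e y x.
  by apply/eqP; rewrite eqn_leq !le_dist.
move=> x y; apply: dist_le_walk.
have /walk_of_lengthP [p [<- pth lst]] := dist_walk y x.
apply/walk_of_lengthP; exists (rev (belast y p)).
split; first by rewrite size_rev size_belast.
  by rewrite -lst rev_path (eq_path (e' := e)).
by case: p lst {pth} => [|a p] //= _; rewrite rev_cons last_rcons.
Qed.

Lemma dist_edge w u v : e u v -> dist e w v <= (dist e w u).+1.
Proof.
move=> uv; apply: dist_le_walk.
have /walk_of_lengthP [p [<- pth lst]] := dist_walk w u.
apply/walk_of_lengthP; exists (rcons p v).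
by rewrite size_rcons rcons_path pth lst uv last_rcons.
Qed.

Lemma dist_edge_bounds w u v : e u v ->
  dist e w v <= (dist e w u).+1 /\ dist e w u <= (dist e w v).+1.
Proof. by move=> uv; split; apply: dist_edge; rewrite // e_sym. Qed.

(** Since d(w, u) and d(w, v) differ by at most 1, every vertex w contributes
    max(d(w, u), d(w, v)) to each side. *)
Lemma transmission_closer u v : e u v ->
  transmission e u + closer e u v = transmission e v + closer e v u.
Proof.
move=> uv; rewrite /transmission /closer !card_sum_nat -!big_split /=.
apply: eq_bigr => w _; rewrite !(dist_sym _ w).
by have := dist_edge_bounds w uv; lia.
Qed.

Definition equidistant u v : {set T} := [set w | dist e w u == dist e w v].

Lemma closer_total u v :
  closer e u v + closer e v u + #|equidistant u v| = #|T|.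
Proof.
rewrite /closer /equidistant !card_sum_nat -sum1_card -!big_split /=.
by apply: eq_bigr => w _; case: ltngtP.
Qed.

Lemma edge_bound u v : e u v ->
  transmission e u ^ 2 + transmission e v ^ 2
      + 4 * (closer e u v * closer e v u)
    <= #|T| ^ 2 + 2 * (transmission e u * transmission e v)
    ?= iff (equidistant u v == set0).
Proof.
move=> uv; have := transmission_closer uv; have := closer_total u v.
rewrite -cards_eq0.
move: #|T| #|equidistant u v| (closer e u v) (closer e v u).
move: (transmission e u) (transmission e v) => s t n c a b <- st.
(* The slack n^2 - (a + b)^2, for n = a + b + c. *)
have -> : (a + b + c) ^ 2 + 2 * (s * t) =
          s ^ 2 + t ^ 2 + 4 * (a * b) + c * (2 * (a + b) + c).
  case: (leqP a b) => [le_ab|lt_ba].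
    have [k [-> ->]] : exists k, b = a + k /\ s = t + k by exists (b - a); lia.
    by ring.
  have [k [-> ->]] : exists k, a = b + k /\ t = s + k by exists (a - b); lia.
  by ring.
by split; [exact: leq_addr | nia].
Qed.

Lemma edgesP E : reflect (exists u v, e u v /\ E = [set u; v]) (E \in edges e).
Proof.
apply: (iffP imset2P) => [[u v _ uv ->]|[u [v [uv ->]]]]; first by exists u, v.
by exists u v.
Qed.

Lemma edge_neq u v : e u v -> u != v.
Proof. by apply: contraTneq => ->; rewrite e_irr. Qed.

Lemma degree_edges u : degree e u = #|[set E in edges e | u \in E]|.
Proof.
rewrite /degree -(card_in_imset (f := fun v => [set u; v])); last first.
  move=> v w; rewrite !inE => uv uw /setP /(_ v).
  by rewrite !inE eqxx orbT eq_sym (negPf (edge_neq uv)) => /esym/eqP.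
apply: eq_card => E; rewrite inE.
apply/imsetP/andP => [[v]|[/edgesP [x [y [xy ->]]]]].
  rewrite inE => uv ->; split; last by rewrite !inE eqxx.
  by apply/edgesP; exists u, v.
rewrite !inE => /orP [/eqP ->|/eqP ->]; first by exists y; rewrite ?inE.
by exists x; rewrite ?inE 1?e_sym // setUC.
Qed.

Lemma handshake (f : T -> nat) :
  \sum_u degree e u * f u = \sum_(E in edges e) \sum_(u in E) f u.
Proof.
rewrite (exchange_big_dep xpredT) //=; apply: eq_bigr => u _.
by rewrite degree_edges sum_nat_const cardsE.
Qed.

Lemma big_edge (R : Type) (idx : R) (op : Monoid.com_law idx) u v (F : T -> R) :
  u != v -> \big[op/idx]_(x in [set u; v]) F x = op (F u) (F v).
Proof. by move=> uv; rewrite big_setU1 ?inE // big_set1. Qed.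

Lemma prod_closer_edge u v : u != v ->
  \prod_(x in [set u; v]) \prod_(y in [set u; v] :\ x) closer e x y
    = closer e u v * closer e v u.
Proof.
move=> uv; rewrite big_edge // setU1K ?inE // setUC setU1K ?inE 1?eq_sym //.
by rewrite !big_set1.
Qed.

(** Every step of a walk crosses between [A] and its complement. *)
Lemma bipartite_walk_parity (A : {set T}) u p :
  (forall x y, e x y -> (x \in A) != (y \in A)) -> path e u p ->
  odd (size p) = ((u \in A) != (last u p \in A)).
Proof.
move=> propA; elim: p u => [|v p IHp] u /=; first by rewrite eqxx.
case/andP => /propA uv /IHp ->.
by move: uv; do 3!case: (_ \in A).
Qed.

(** From left to right, walks of one length from w to both ends of an edge
    would put these ends on the same side.  From right to left, the distances
    from a root to the ends of an edge differ by exactly 1. *)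
Lemma bipartite_noequidistant :
  bipartite e <-> forall u v, e u v -> equidistant u v = set0.
Proof.
split=> [[A propA] u v uv|noeq].
  apply/setP => w; rewrite !inE; apply: contraNF (propA _ _ uv) => /eqP eq_d.
  have /walk_of_lengthP [p [szp pthp lstp]] := dist_walk w u.
  have /walk_of_lengthP [q [szq pthq lstq]] := dist_walk w v.
  have := bipartite_walk_parity propA pthp.
  rewrite szp eq_d -szq (bipartite_walk_parity propA pthq) lstp lstq.
  by do 3!case: (_ \in A).
case: (pickP (@predT T)) => [w _|T0]; last by exists set0 => u; have := T0 u.
exists [set u | odd (dist e w u)] => u v uv; rewrite !inE.
have := dist_edge_bounds w uv; have /setP /(_ w) := noeq _ _ uv.
rewrite !inE; lia.
Qed.

(** The sum of the bounds of [edge_bound] over all edges; it is tight iff each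
    of them is.  All terms are moved to their positive side, which keeps the
    computation in the natural numbers. *)
Lemma graph_bound :
  exists2 C : bool, C <-> bipartite e &
  MSD32 e + 4 * Szeged e <= #|T| ^ 2 * #|edges e| + 2 * MS2 e ?= iff C.
Proof.
pose lhs (E : {set T}) := \sum_(u in E) transmission e u ^ 2
  + 4 * \prod_(u in E) \prod_(v in E :\ u) closer e u v.
pose rhs (E : {set T}) := #|T| ^ 2 + 2 * \prod_(u in E) transmission e u.
have local u v : e u v ->
    lhs [set u; v] <= rhs [set u; v] ?= iff (equidistant u v == set0).
  move=> uv; have neq_uv := edge_neq uv.
  rewrite /lhs /rhs prod_closer_edge // !(big_edge _ _ neq_uv).
  exact: edge_bound.
exists [forall (E | E \in edges e), lhs E == rhs E].
  rewrite bipartite_noequidistant; split=> [/forall_inP tight u v uv|noeq].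
    apply/eqP; rewrite -(local u v uv); apply: tight.
    by apply/edgesP; exists u, v.
  apply/forall_inP => E /edgesP [u [v [uv ->]]].
  by rewrite (local u v uv) noeq.
rewrite /MSD32 handshake /Szeged /MS2 [_ ^ 2 * _]mulnC -sum_nat_const.
rewrite !big_distrr /= -!big_split; apply: leqif_sum => E /edgesP [u [v [uv ->]]].
by apply: leqif_eq; apply: (local u v uv).
Qed.

End GraphDistance.

Local Open Scope ring_scope.

Theorem proposition5 (T : finType) (e : rel T) (n m : nat)
    (e_sym : symmetric e) (e_irr : irreflexive e) (e_conn : connected e)
    (card_vertices : #|T| = n) (card_edges : #|edges e| = m) :
  let rhs : int :=
    (MSD32 e)%:Z + 4 * (Szeged e)%:Z - 2 * (MS2 e)%:Z in
  rhs <= n%:Z ^+ 2 * m%:Z /\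
  (n%:Z ^+ 2 * m%:Z = rhs <-> bipartite e).
Proof.
have [C bipC []] := graph_bound e_sym e_irr e_conn.
rewrite card_vertices card_edges => le_nat eqC /=.
split; first by lia.
split=> [eq_int|/bipC]; last by rewrite -eqC => /eqP; lia.
by apply/bipC; rewrite -eqC; apply/eqP; lia.
Qed.
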